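(* Let $X$ and $Y$ be Banach spaces, and let $\mathcal{E}$ be a $1$-unconditional basic sequence. If there exists a coarse embedding $X\to Y$, then there exists a continuous coarse embedding $f:X\to(\oplus Y)_{\mathcal{E}}$ with uniformly continuous inverse $f^{-1}:f(X)\to X$ (so $f$ is injective). In particular, there exists a map $X\to(\oplus Y)_{\mathcal{E}}$ which is simultaneously a homeomorphism onto its image and a coarse embedding.
   Context: For a map $f:(M,d)\to(N,\partial)$ between metric spaces and $t\ge 0$, let $\omega_f(t)=\sup\{\partial(f(x),f(y)) : d(x,y)\le t\}$ and $\rho_f(t)=\inf\{\partial(f(x),f(y)) : d(x,y)\ge t\}$ (with $\inf\emptyset=\infty$). $f$ is coarse if $\omega_f(t)<\infty$ for all $t\ge 0$; expanding if $\lim_{t\to\infty}\rho_f(t)=\infty$; a coarse embedding (not assumed continuous) if it is both coarse and expanding. If $\mathcal{E}=(e_n)_{n\in\mathbb{N}}$ is a $1$-unconditional basic sequence and $Y$ is a Banach space, $(\oplus Y)_{\mathcal{E}}$ is the Banach space of sequences $(y_n)_n$ in $Y$ for which $\sum_n\|y_n\|e_n$ converges, with norm $\|(y_n)_n\|=\left\|\sum_n\|y_n\|e_n\right\|$. *)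

(* Defs.v *)
From HB Require Import structures.
From mathcomp Require Import all_boot all_order all_algebra.
From mathcomp Require Import all_classical all_reals all_analysis.

Set Implicit Arguments.
Unset Strict Implicit.
Unset Printing Implicit Defensive.

Import Order.TTheory GRing.Theory Num.Theory.
Import numFieldNormedType.Exports.

Local Open Scope classical_set_scope.
Local Open Scope ring_scope.

Section CoarseEmbeddings.
Context {R : realType} {V W : normedModType R}.
Implicit Type f : V -> W.

Definition omega f (t : R) : \bar R :=
  ereal_sup [set (`|f p.1 - f p.2|%:E)%E | p in [set p : V * V | `|p.1 - p.2| <= t]].

Definition rho f (t : R) : \bar R :=
  ereal_inf [set (`|f p.1 - f p.2|%:E)%E | p in [set p : V * V | t <= `|p.1 - p.2|]].

Definition coarse f := forall t : R, 0 <= t -> (omega f t < +oo)%E.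

Definition expanding f := rho f t @[t --> +oo%R] --> +oo%E.

Definition coarse_embedding f := coarse f /\ expanding f.

(* Uniform continuity (resp. continuity) of the inverse is taken with respect
   to the uniformity (resp. topology) induced on [range f]; the values of the
   total function [g] outside [range f] are irrelevant. *)
Definition unif_continuous_inverse f :=
  exists2 g : W -> V, cancel f g & unif_continuous (g : subspace (range f) -> V).

Definition homeomorphism_onto_image f :=
  continuous f /\
  exists2 g : W -> V, cancel f g & {within range f, continuous g}.

End CoarseEmbeddings.

Section BasicSequences.
Context {R : realType} {E : normedModType R}.
Implicit Type e : nat -> E.

Definition linear_span e : set E :=
  [set x | exists n (a : nat -> R), x = \sum_(k < n) a k *: e k].

(* [e] is a Schauder basis of its closed linear span. *)
Definition basic_sequence e :=
  forall x, closure (linear_span e) x ->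
    exists! a : nat -> R, series (fun k => a k *: e k) @ \oo --> x.

(* The unconditional basis constant, i.e. the least [K] such that
   |sum_k a_k e_k| <= K |sum_k b_k e_k| whenever |a_k| <= |b_k| for all k, is 1.
   No normalization of [e] is required. *)
Definition one_unconditional_basic_sequence e :=
  basic_sequence e /\
  forall (n : nat) (a b : nat -> R), (forall k, `|a k| <= `|b k|) ->
    `|\sum_(k < n) a k *: e k| <= `|\sum_(k < n) b k *: e k|.

End BasicSequences.

Section UnconditionalTheory.
Context {R : realType} {E : completeNormedModType R} {e : nat -> E}.
Context (he : one_unconditional_basic_sequence e).
Implicit Types a b : nat -> R.

Lemma basic_sequence_neq0 k : e k != 0.
Proof.
apply/eqP => ek0.
have /(he.1) [a [_ ua]] : closure (linear_span e) 0.
  by apply: subset_closure; exists 0%N, (fun=> 0); rewrite big_ord0.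
have s0 : forall b, (forall j, b j *: e j = 0) ->
    series (fun j => b j *: e j) @ \oo --> (0 : E).
  move=> b b0; rewrite (_ : series _ = fun=> 0); first exact: cvg_cst.
  by apply/funext => n; rewrite /series/= big1.
have a0 := ua (fun=> 0) (s0 _ (fun j => scale0r _)).
have : a = (fun j => (j == k)%:R).
  apply: ua; apply: s0 => j; case: eqP => [->|_]; first by rewrite ek0 scaler0.
  exact: scale0r.
rewrite a0 => /(congr1 (@^~ k)); rewrite eqxx => /esym/eqP.
by rewrite oner_eq0.
Qed.

Lemma unconditional_le_nat m n a b : (forall k, `|a k| <= `|b k|) ->
  `|\sum_(m <= k < n) a k *: e k| <= `|\sum_(m <= k < n) b k *: e k|.
Proof.
move=> ab.
pose tail c k : R := if (m <= k)%N then c k else 0.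
have H c : \sum_(m <= k < n) c k *: e k = \sum_(k < n) tail c k *: e k.
  rewrite big_geq_mkord big_mkcond/=; apply: eq_bigr => k _.
  by rewrite /tail; case: ifP => // _; rewrite scale0r.
rewrite !H; apply: (he.2 n (tail a) (tail b)) => k.
by rewrite /tail; case: ifP.
Qed.

Lemma unconditional_le_series n a b : (forall k, `|a k| <= `|b k|) ->
  `|series (fun k => a k *: e k) n| <= `|series (fun k => b k *: e k) n|.
Proof. exact: unconditional_le_nat. Qed.

Lemma unconditional_is_cvg a b : (forall k, `|a k| <= `|b k|) ->
  cvgn (series (fun k => b k *: e k)) -> cvgn (series (fun k => a k *: e k)).
Proof.
move=> ab /cvg_cauchy/cauchy_seriesP cb.
apply: cauchy_cvg; apply/cauchy_seriesP => d /cb.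
by apply: filterS => -[m n] /=; exact/le_lt_trans/unconditional_le_nat.
Qed.

Lemma unconditional_le_lim a b : (forall k, `|a k| <= `|b k|) ->
  cvgn (series (fun k => b k *: e k)) ->
  `|limn (series (fun k => a k *: e k))| <=
  `|limn (series (fun k => b k *: e k))|.
Proof.
move=> ab cb; have ca := unconditional_is_cvg ab cb.
apply: (ler_cvg_to (cvg_norm ca) (cvg_norm cb)).
by apply: nearW => n; exact: unconditional_le_series.
Qed.

Lemma unconditional_sum_le_lim m n a : cvgn (series (fun k => a k *: e k)) ->
  `|\sum_(m <= k < n) a k *: e k| <= `|limn (series (fun k => a k *: e k))|.
Proof.
move=> ca; apply: (cvgr_to_ge (cvg_norm ca)).
exists n => // N /= nN.
pose b k := if (m <= k < n)%N then a k else 0.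
rewrite (_ : \sum_(m <= k < n) _ = series (fun k => b k *: e k) N).
  by apply: unconditional_le_series => k; rewrite /b; case: ifP; rewrite ?normr0.
rewrite (@big_nat_widenl _ _ _ m 0)// (big_nat_widen _ _ _ _ _ nN) big_mkcond/=.
by apply: eq_bigr => k _; rewrite /b; case: ifP => //; rewrite scale0r.
Qed.

Lemma unconditional_coord a k : cvgn (series (fun k => a k *: e k)) ->
  `|a k| * `|e k| <= `|limn (series (fun k => a k *: e k))|.
Proof.
by move=> /(unconditional_sum_le_lim k k.+1); rewrite big_nat1 normrZ.
Qed.

End UnconditionalTheory.

Section DirectSumPred.
Context {R : realType} (Y E : completeNormedModType R) (e : nat -> E).

Definition summable_along (he : one_unconditional_basic_sequence e) :
    {pred nat -> Y} :=
  fun y => `[< cvgn (series (fun n => `|y n| *: e n)) >].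

End DirectSumPred.
Arguments summable_along {R} Y {E e} he.

Record oplus (R : realType) (Y E : completeNormedModType R) (e : nat -> E)
    (he : one_unconditional_basic_sequence e) := Oplus {
  oplus_val :> nat -> Y ;
  oplus_valP : oplus_val \in summable_along Y he }.
Arguments oplus {R} Y {E e} he.

Section DirectSum.
Context {R : realType} (Y E : completeNormedModType R) (e : nat -> E).
Context (he : one_unconditional_basic_sequence e).
Local Notation V := (oplus Y he).

HB.instance Definition _ := [isSub for @oplus_val R Y E e he].
HB.instance Definition _ := [Choice of V by <:].

Lemma summable_alongP (y : nat -> Y) :
  (y \in summable_along Y he) <-> cvgn (series (fun n => `|y n| *: e n)).
Proof. by split=> [/asboolP|/asboolP]. Qed.

Let cvgnZ (a : R) (y : nat -> Y) :
  series (fun n => `|(a *: y) n| *: e n) =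
  `|a| *: series (fun n => `|y n| *: e n).
Proof.
rewrite -seriesZ; congr series; apply/funext => n.
by rewrite /= fctE normrZ -scalerA.
Qed.

Let dom_add (y z : nat -> Y) n : `| `|(y + z) n| | <= `| `|y n| + `|z n| |.
Proof. by rewrite ger0_norm// ger0_norm ?addr_ge0//; exact: ler_normD. Qed.

Let series_add (y z : nat -> Y) :
  series (fun n => (`|y n| + `|z n|) *: e n) =
  series (fun n => `|y n| *: e n) + series (fun n => `|z n| *: e n).
Proof.
by rewrite -seriesD; congr series; apply/funext => n /=; rewrite scalerDl.
Qed.

Lemma summable_along_submod_closed : submod_closed (summable_along Y he).
Proof.
split.
  apply/summable_alongP; rewrite (_ : (fun _ => _) = 0 *: e).
    by rewrite seriesZ scale0r; exact: is_cvg_cst.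
  by apply/funext => n; rewrite /= normr0.
move=> a y z /summable_alongP cy /summable_alongP cz; apply/summable_alongP.
apply: (unconditional_is_cvg he (dom_add _ _)); rewrite series_add.
by apply: is_cvgD => //; rewrite cvgnZ; exact: is_cvgZl_tmp.
Qed.

HB.instance Definition _ := GRing.isSubmodClosed.Build R (nat -> Y)
  (summable_along Y he) summable_along_submod_closed.
HB.instance Definition _ := [SubChoice_isSubLmodule of V by <:].

Definition oplus_norm (y : V) : R :=
  `|limn (series (fun n => `|y n| *: e n))|.

Let is_cvg_oplus (y : V) : cvgn (series (fun n => `|y n| *: e n)).
Proof. exact/summable_alongP/oplus_valP. Qed.

Let oplus_normD (y z : V) : oplus_norm (y + z) <= oplus_norm y + oplus_norm z.
Proof.
rewrite (le_trans (unconditional_le_lim he (dom_add y z) _))//.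
  by rewrite series_add; exact: is_cvgD.
by rewrite series_add limD//; exact: ler_normD.
Qed.

Let oplus_normZ (a : R) (y : V) : oplus_norm (a *: y) = `|a| * oplus_norm y.
Proof.
by rewrite /oplus_norm cvgnZ (limZl_tmp _ (@is_cvg_oplus y)) normrZ normr_id.
Qed.

Let oplus_coord (y : V) k : `|y k| * `|e k| <= oplus_norm y.
Proof. by rewrite -(normr_id (y k)); exact: (unconditional_coord he). Qed.

Let oplus_norm_eq0 (y : V) : oplus_norm y = 0 -> y = 0.
Proof.
move=> y0; apply/val_inj/funext => k /=; apply/eqP; rewrite -normr_eq0.
have := oplus_coord y k; rewrite y0 pmulr_lle0 ?normr_gt0 ?basic_sequence_neq0//.
by rewrite normr_le0 normr_eq0.
Qed.

HB.instance Definition _ := Lmodule_isNormed.Build R V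
  oplus_normD oplus_normZ oplus_norm_eq0.

Lemma oplus_normE (y : V) : `|y| = `|limn (series (fun n => `|y n| *: e n))|.
Proof. by []. Qed.

Lemma oplus_complete (F : set_system V) : ProperFilter F -> cauchy F -> cvg F.
Proof.
move=> FF /cauchyP Fc.
have small d : 0 < d -> exists2 A, F A &
    forall y z : V, A y -> A z -> `|y - z| <= d.
  move=> d0; have d20 : 0 < d / 2 by rewrite divr_gt0.
  have [x Fx] := Fc _ d20; exists (ball x (d / 2)) => // y z.
  rewrite -ball_normE /ball_/= => xy xz.
  rewrite (splitr d) (le_trans (ler_distD x _ _))// lerD// ?ltW//.
  by rewrite distrC.
have coord_cvg k : cvg ((fun y : V => y k) @ F).
  have ek : 0 < `|e k| by rewrite normr_gt0 basic_sequence_neq0.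
  apply: cauchy_cvg; apply/cauchyP => d d0.
  have [] := small (d / 2 * `|e k|); first by rewrite mulr_gt0// divr_gt0.
  move=> A FA Asmall; have [x Ax] := filter_ex FA.
  exists (x k); rewrite nbhs_filterE/=; apply: filterS FA => y Ay /=.
  rewrite -ball_normE/= (@le_lt_trans _ _ (d / 2))//; last first.
    by rewrite ltr_pdivrMr// ltr_pMr// ltr1n.
  by rewrite -(ler_pM2r ek) (le_trans _ (Asmall _ _ Ax Ay))// (oplus_coord (x - y)).
pose l k := lim ((fun y : V => y k) @ F).
have close d : 0 < d -> exists2 A, F A & forall z : V, A z -> forall m n,
    `|\sum_(m <= k < n) `|l k - z k| *: e k| <= d.
  move=> d0; have [A FA Asmall] := small d d0; exists A => // z Az m n.
  have H : (fun y : V => `|\sum_(m <= k < n) `|y k - z k| *: e k|) @ F -->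
      `|\sum_(m <= k < n) `|l k - z k| *: e k|.
    apply: cvg_norm; apply: cvg_big => [|k _]; first exact: add_continuous.
    apply: cvgZr_tmp; apply: cvg_norm; apply: cvgB; last exact: cvg_cst.
    exact: coord_cvg.
  apply: (cvgr_to_le H); apply: filterS FA => y Ay.
  apply: le_trans (Asmall _ _ Ay Az); rewrite oplus_normE.
  exact: (@unconditional_sum_le_lim _ _ _ he m n (fun k => `|(y - z) k|) (@is_cvg_oplus (y - z))).

have lP : l \in summable_along Y he.
  apply/summable_alongP; apply: cauchy_cvg; apply/cauchy_seriesP => d d0.
  have d20 : 0 < d / 2 by rewrite divr_gt0.
  have [A FA Aclose] := close _ d20; have [z Az] := filter_ex FA.
  have /cvg_cauchy/cauchy_seriesP/(_ _ d20) := @is_cvg_oplus z.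
  apply: filterS => -[m n] /= zmn.
  have dom k : `| `|l k| | <= `| `|l k - z k| + `|z k| |.
    by rewrite ger0_norm// ger0_norm ?addr_ge0// -lerBlDr lerB_dist.
  rewrite (le_lt_trans (unconditional_le_nat he m n dom))//.
  under eq_bigr do rewrite scalerDl.
  rewrite big_split/= (splitr d) (le_lt_trans (ler_normD _ _))// ler_ltD//.
  exact: Aclose.
apply/cvg_ex; exists (Oplus lP); apply/cvgrPdist_le => d /close[A FA Aclose].
apply: filterS FA => z Az; rewrite oplus_normE.
apply: (cvgr_to_le (cvg_norm (@is_cvg_oplus (Oplus lP - z)))).
by apply: nearW => n; exact: Aclose.
Qed.

HB.instance Definition _ := Uniform_isComplete.Build V oplus_complete.

End DirectSum.

(* Main.v *)
Require Import Defs.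
From mathcomp Require Import all_boot all_order all_algebra.
From mathcomp Require Import all_classical all_reals all_analysis.
From mathcomp Require Import wochoice lra.

(** Why the theorem holds. A coarse embedding [phi] moves points at distance at
    most [1] by at most some [C], so averaging its values with a locally finite
    partition of unity of mesh [1] gives a continuous [psi] within [C] of [phi]
    ([continuous_approximation]), which is again a coarse embedding. As the
    domain is a normed space, segments can be subdivided, and coarseness
    improves to an affine bound [|psi x - psi y| <= C * (|x - y| + 1)]
    ([coarse_affine_bound]).

    The map [psi] separates distant points only. To separate points at every
    scale, look at them through ever stronger magnifying glasses, one per
    coordinate: the [n]-th coordinate of [f x] is [psi ((n + 1) x)], multiplied
    by a positive weight that decays fast enough for the affine bound to make
    the coordinates of [f x - f y] geometrically summable, with a total
    controlled by [|x - y|]. This makes [f] well defined and coarse, and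
    continuous because the tails are small uniformly near each point. The
    coordinate [0] is [psi] up to a factor, whence [f] is expanding. If
    [|x - y| >= d], then some magnification [n + 1], depending only on [d],
    sends [x] and [y] to points that [psi] keeps at distance at least [1], so
    [|f x - f y|] is at least a positive constant depending only on [d]: this is
    injectivity and uniform continuity of the inverse. The norm of the
    [E]-sum enters through two estimates: it dominates [|y n| * |e n|] for each
    [n] ([oplus_coord_le]), and it is at most the sum of these numbers, up to a
    small error when they decay geometrically ([oplus_norm_le]).

    The space need not be separable, so the partition of unity relies on the
    paracompactness of metric spaces, obtained here by transfinite stick
    breaking. Well-order the points and let [tent x a = max 0 (1 - |x - a|)].
    The running supremum of [tent x] along the well-order climbs from [0] to
    [tent x x = 1], and [a] receives the height of the jump made at [a]. These
    heights are Lipschitz in [x], vanish when [|x - a| >= 1], and have sum [1].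
    Having sum [1], they are small outside a finite set of indices, uniformly
    near a given point; subtracting half of their maximum and truncating at [0]
    makes the family locally finite. *)

Set Implicit Arguments.
Unset Strict Implicit.
Unset Printing Implicit Defensive.

Import Order.TTheory GRing.Theory Num.Theory.
Import numFieldNormedType.Exports.

Local Open Scope classical_set_scope.
Local Open Scope ring_scope.

(** * Suprema of bounded families *)

Lemma sup_range_le (R : realType) (I : Type) (i0 : I) (f : I -> R) (c : R) :
  (forall i, f i <= c) -> sup (range f) <= c.
Proof.
by move=> fc; apply: ge_sup => [|_ [i _ <-]]; [exists (f i0), i0|exact: fc].
Qed.

Lemma le_sup_range (R : realType) (I : Type) (f : I -> R) (c : R) i :
  (forall j, f j <= c) -> f i <= sup (range f).
Proof.
by move=> fc; apply: ub_le_sup; [exists c => _ [j _ <-]; exact: fc|exists i].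
Qed.

Lemma sup_range_dist (R : realType) (I : Type) (i0 : I) (f g : I -> R)
    (c d : R) :
  (forall i, f i <= c) -> (forall i, g i <= c) ->
  (forall i, `|f i - g i| <= d) ->
  `|sup (range f) - sup (range g)| <= d.
Proof.
move=> fc gc fg.
have half (u v : I -> R) : (forall i, v i <= c) ->
    (forall i, `|u i - v i| <= d) -> sup (range u) - sup (range v) <= d.
  move=> vc uv; rewrite lerBlDr; apply: sup_range_le => // i.
  have := le_sup_range i vc; have := le_trans (ler_norm _) (uv i); lra.
rewrite ler_norml half// andbT lerNl opprB half// => i.
by rewrite distrC.
Qed.

(** * Stick breaking along a well-order *)

Section Gain.
Context {R : realType} {I : choiceType} (r : rel I) (wo : well_order r).
Implicit Types (a b : I) (h k : I -> R) (s : seq I).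

Let rtot : total r.
Proof. by move=> a b; apply: (@wo_chainW _ r predT (withinW wo)). Qed.

Let ranti a b : r a b -> r b a -> a = b.
Proof.
move=> ab ba; apply: (wo_chain_antisymmetric (C := predT) (withinW wo)) => //.
by rewrite ab.
Qed.

Let rtrans : transitive r.
Proof.
move=> y x z xy yz.
have ne : nonempty [pred u | u \in [:: x; y; z]] by exists x; rewrite !inE eqxx.
have [m [[]]] := wo ne.
rewrite !inE => /or3P[]/eqP-> /(_ _ _)/= H _.
- by apply: H; rewrite !inE eqxx !orbT.
- by rewrite (ranti xy) //; apply: H; rewrite !inE eqxx.
- by rewrite -(ranti yz) //; apply: H; rewrite !inE eqxx !orbT.
Qed.

(** Terms that are not earlier than [a] count as [0] instead of being left out,
    so that the first element of the well-order gets the value [0] and not the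
    supremum of an empty set. *)
Definition earlier_sup h a : R :=
  sup (range (fun b => if (b != a) && r b a then h b else 0)).

(** This is the jump at [a] of the running supremum of [h]. *)
Definition gain h a : R := Num.max 0 (h a - earlier_sup h a).

Lemma gain_dist h k a d :
  (forall b, h b <= 1) -> (forall b, k b <= 1) ->
  (forall b, `|h b - k b| <= d) -> `|gain h a - gain k a| <= 2 * d.
Proof.
move=> h1 k1 hk; have d0 : 0 <= d by apply: le_trans (hk a).
have : `|earlier_sup h a - earlier_sup k a| <= d.
  by apply: (@sup_range_dist _ _ a _ _ 1) => b; case: ifP => // _;
    rewrite ?subrr ?normr0.
have := hk a; rewrite /gain !ler_norml => /andP[? ?] /andP[? ?].
by rewrite /Num.max; case: ltP => ?; case: ltP => ?; apply/andP; split; lra.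
Qed.

Section Fixed.
Context (h : I -> R) (h0 : forall a, 0 <= h a) (h1 : forall a, h a <= 1).

Let cut_le1 a b : (if (b != a) && r b a then h b else 0) <= 1.
Proof. by case: ifP. Qed.

Lemma earlier_sup_ge0 a : 0 <= earlier_sup h a.
Proof. by have := le_sup_range a (cut_le1 a); rewrite eqxx. Qed.

Lemma gain_le a : gain h a <= h a.
Proof. by rewrite ge_max h0 gerBl earlier_sup_ge0. Qed.

(** The jumps of a nondecreasing function add up to at most its final value.
    Induction on [s] in decreasing order: if the largest element [m] of [s]
    makes a jump, it jumps from [earlier_sup h m], which bounds [h] on the rest
    of [s], up to [h m], hence the induction over an arbitrary bound [c]. *)
Lemma sum_gain_le s c : uniq s -> 0 <= c -> (forall a, a \in s -> h a <= c) ->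
  \sum_(a <- s) gain h a <= c.
Proof.
pose geT a b := r b a.
rewrite -(perm_big _ (permEl (perm_sort geT s)))/= -(sort_uniq geT) => us c0 hc.
have {hc} : forall a, a \in sort geT s -> h a <= c.
  by move=> a; rewrite mem_sort; exact: hc.
have : sorted geT (sort geT s) by apply: sort_sorted => a b; exact: rtot.
have geT_trans : transitive geT by move=> y x z xy yz; exact: rtrans yz xy.
rewrite sorted_pairwise// => ps.
elim: (sort geT s) c c0 us ps => [|m t IHt] c c0 /=; first by rewrite big_nil.
move=> /andP[mt ut] /andP[/allP/= mge pt] hc; rewrite big_cons.
rewrite {1}/gain; have [hm|hm] := leP (h m) (earlier_sup h m).
  rewrite max_l ?subr_le0// add0r; apply: IHt => // b bt.
  by apply: hc; rewrite inE bt orbT.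
rewrite max_r; last by rewrite subr_ge0 ltW.
apply: (@le_trans _ _ (h m)); last by apply: hc; rewrite inE eqxx.
rewrite -lerBrDl opprB addrC subrK; apply: IHt => //.
  exact: earlier_sup_ge0.
move=> b bt; have := le_sup_range b (cut_le1 m).
rewrite [r b m](mge _ bt) andbT ifT//.
by apply: contraNneq mt => <-.
Qed.

(** The running supremum has no growth other than its jumps: at a limit stage it
    is approached from below, at the cost of an arbitrarily small error. This is
    transfinite induction on [a], run on a least counterexample [m]: unless
    [earlier_sup h m] is negligible, some [b] earlier than [m] with [h b] close
    to it supplies the first part of the sum, and [m] itself the last jump. *)
Lemma sum_gain_approx a e : 0 < e ->
  exists s, [/\ uniq s, forall b, b \in s -> r b a &
    h a - e <= \sum_(b <- s) gain h b].
Proof.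
move: e; apply: contrapT => nPa.
pose P b := forall e, 0 < e -> exists s,
  [/\ uniq s, forall b', b' \in s -> r b' b &
    h b - e <= \sum_(b' <- s) gain h b'].
have ne : nonempty [pred b | `[< ~ P b >]] by exists a; apply/asboolP.
have [m [[/asboolP nPm mmin] _]] := wo ne.
have {mmin} IH b : (b != m) && r b m -> P b.
  move=> /andP[bm rbm]; apply: contrapT => nPb.
  by move: bm; rewrite (ranti rbm) ?eqxx//; apply: mmin; apply/asboolP.
apply: nPm => e e0.
have e20 : 0 < e / 2 by rewrite divr_gt0.
have [|_ [b _ <-] ble] := @sup_adherent _
    (range (fun b => if (b != m) && r b m then h b else 0)) _ e20.
  split; first by exists 0, m; rewrite ?eqxx.
  by exists 1 => _ [b _ <-].
have gm : h m - earlier_sup h m <= gain h m by rewrite le_max lexx orbT.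
have rmm : r m m by have := rtot m m; rewrite orbb.
rewrite -/(earlier_sup h m) in ble.
case: ifP ble => [bm ble|_ ble]; last first.
  exists [:: m]; rewrite big_seq1; split=> // [b'|]; last by lra.
  by rewrite inE => /eqP->.
have [s [us sb hs]] := IH _ bm _ e20.
case/andP: bm => bm rbm.
exists (m :: s); rewrite big_cons/= us andbT; split; last by lra.
- apply: contraNN bm => /sb mb; apply/eqP; exact: ranti.
- by move=> b'; rewrite inE => /orP[/eqP->//|/sb/rtrans]; apply.
Qed.
End Fixed.
End Gain.

(** * A locally finite partition of unity *)

Lemma dist_le_continuous (R : realType) (V W : normedModType R) (K : R)
    (f : V -> W) :
  (forall x y, `|f x - f y| <= K * `|x - y|) -> continuous f.
Proof.
move=> fK x; apply/cvgrPdist_lt => e e0.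
have K0 : 0 < `|K| + 1 by rewrite ltr_wpDl.
near=> y; apply: le_lt_trans (fK x y) _.
apply: (@le_lt_trans _ _ ((`|K| + 1) * `|x - y|)).
  by rewrite ler_wpM2r// (le_trans (ler_norm K))// lerDl.
rewrite mulrC -ltr_pdivlMr//; near: y.
by apply: (cvgr_dist_lt (FF := nbhs_filter x)); [exact: cvg_id|rewrite divr_gt0].
Unshelve. all: by end_near. Qed.

Lemma continuous_sum (R : realType) (V W : normedModType R) (I : Type)
    (s : seq I) (F : I -> V -> W) :
  (forall i, continuous (F i)) -> continuous (fun x => \sum_(i <- s) F i x).
Proof.
by move=> Fc; apply: continuous_big => [|i _];
  [exact: add_continuous|exact: Fc].
Qed.

Section PartitionOfUnity.
Context {R : realType} {V : normedModType R}.

Definition tent (x a : V) : R := Num.max 0 (1 - `|x - a|).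

Lemma tent_ge0 x a : 0 <= tent x a.
Proof. by rewrite le_max lexx. Qed.

Lemma tent_le1 x a : tent x a <= 1.
Proof. by rewrite ge_max ler01 gerBl normr_ge0. Qed.

Lemma tent_dist x y a : `|tent x a - tent y a| <= `|x - y|.
Proof.
have := ler_distD y x a; have := ler_distD x y a; rewrite (distrC y x).
have := normr_ge0 (x - y); rewrite /tent ler_norml /Num.max => ? ? ?.
by case: ltP => ?; case: ltP => ?; apply/andP; split; lra.
Qed.

Variables (r : rel V) (wo : well_order r).

(** The piece of the unit stick given to [a] at the point [x]. *)
Definition stick (a x : V) : R := gain r (tent x) a.

Lemma stick_dist a x y : `|stick a x - stick a y| <= 2 * `|x - y|.
Proof.
by apply: gain_dist => b; [exact: tent_le1|exact: tent_le1|exact: tent_dist].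
Qed.

Lemma stick_le1 a x : stick a x <= 1.
Proof.
exact: le_trans (gain_le _ (tent_ge0 x) (tent_le1 x) a) (tent_le1 x a).
Qed.

Lemma sum_stick_approx x e : 0 < e ->
  exists2 s, uniq s & 1 - e <= \sum_(a <- s) stick a x.
Proof.
move=> /(sum_gain_approx wo (tent_le1 x) x)[s [us _ hs]].
by exists s => //; apply: le_trans hs; rewrite /tent subrr normr0 subr0 max_r.
Qed.

(** Finitely many pieces almost exhaust the stick at [x], hence also at nearby
    points by continuity of a finite sum, and there is too little left for any
    other piece. *)
Lemma stick_small_off_finite x e : 0 < e ->
  exists2 s, uniq s &
    \forall y \near (x : V), forall a, a \notin s -> stick a y < e.
Proof.
move=> e0; have e20 : 0 < e / 2 by rewrite divr_gt0.
have [s us hs] := sum_stick_approx x e20; exists s => //.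
have sc : continuous (fun y : V => \sum_(a <- s) stick a y : R^o).
  by apply: continuous_sum => a; exact: dist_le_continuous (stick_dist a).
have /cvgrPdist_lt/(_ _ e20) := sc x.
apply: filterS => y xy a sa.
have : \sum_(b <- a :: s) stick b y <= 1.
  apply: (sum_gain_le wo (tent_le1 y)) => // [|b _].
    by rewrite /= sa.
  exact: tent_le1.
rewrite big_cons; move: xy; rewrite ltr_norml => /andP[_]; lra.
Qed.

Definition max_stick x : R := sup (range (stick^~ x)).

Lemma max_stick_gt0 x : 0 < max_stick x.
Proof.
have e20 : (0 : R) < 1 / 2 by rewrite divr_gt0.
have [s _ hs] := sum_stick_approx x e20.
rewrite ltNge; apply/negP => m0; suff : \sum_(a <- s) stick a x <= 0 by lra.
rewrite big_seq; apply: sumr_le0 => a _; apply: le_trans m0.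
exact: (le_sup_range a (fun b => stick_le1 b x)).
Qed.

Lemma max_stick_dist x y : `|max_stick x - max_stick y| <= 2 * `|x - y|.
Proof.
by apply: (@sup_range_dist _ _ 0 _ _ 1) => a;
  [exact: stick_le1|exact: stick_le1|exact: stick_dist].
Qed.

(** The pieces can all be tiny, so that no constant threshold would do: half of
    the largest piece adapts to the point, and leaves a positive weight. *)
Definition weight a x : R := Num.max 0 (stick a x - max_stick x / 2).

Lemma weight_ge0 a x : 0 <= weight a x.
Proof. by rewrite le_max lexx. Qed.

Lemma weight_dist a x y : `|weight a x - weight a y| <= 3 * `|x - y|.
Proof.
have := stick_dist a x y; have := max_stick_dist x y; rewrite /weight !ler_norml.
move=> /andP[? ?] /andP[? ?].
by rewrite /Num.max; case: ltP => ?; case: ltP => ?; apply/andP; split; lra.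
Qed.

Lemma weight_continuous a : continuous (weight a : V -> R^o).
Proof. exact: dist_le_continuous (weight_dist a). Qed.

Lemma weight_supp a x : weight a x != 0 -> `|x - a| < 1.
Proof.
apply: contraNT; rewrite -leNgt => xa1; apply/eqP/max_l.
have := gain_le r (tent_ge0 x) (tent_le1 x) a.
rewrite {2}/tent max_l ?subr_le0// -/(stick a x) => sa.
have := max_stick_gt0 x; lra.
Qed.

Lemma weight_neq0_ex x : exists a, weight a x != 0.
Proof.
have m0 := max_stick_gt0 x; have m20 : 0 < max_stick x / 2 by rewrite divr_gt0.
have [|_ [a _ <-] hm] := @sup_adherent _ (range (stick^~ x)) _ m20.
  by split; [exists (stick 0 x), 0|exists 1 => _ [a _ <-]; exact: stick_le1].
exists a; rewrite gt_eqF// lt_max; apply/orP; right.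
by rewrite -/(max_stick x) in hm; lra.
Qed.

Lemma weight_locally_finite x :
  exists2 s, uniq s &
    \forall y \near (x : V), forall a, a \notin s -> weight a y = 0.
Proof.
have m0 := max_stick_gt0 x.
have m4 : 0 < max_stick x / 4 by rewrite divr_gt0.
have m2 : 0 < max_stick x / 2 by rewrite divr_gt0.
have [s us hs] := stick_small_off_finite x m4; exists s => //.
have mc : continuous (max_stick : V -> R^o).
  exact: dist_le_continuous max_stick_dist.
have /cvgrPdist_lt/(_ _ m2) := mc x.
apply: filterS2 hs => y hs xy a /hs sa; apply: max_l.
move: xy; rewrite ltr_norml => /andP[_]; lra.
Qed.

End PartitionOfUnity.

(** Only points [a] with [|x - a| < 1] enter the average taken at [x], and there
    [phi a] is within [C] of [phi x]. The sums over the whole space are finitely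
    supported; near each point they range over one common finite list. *)
Lemma continuous_approximation (R : realType) (V W : normedModType R)
    (phi : V -> W) (C : R) :
  (forall x y, `|x - y| <= 1 -> `|phi x - phi y| <= C) ->
  exists2 psi : V -> W, continuous psi & forall x, `|psi x - phi x| <= C.
Proof.
move=> phiC; have [r wo] := @well_ordering_principle V.
pose w := weight r.
pose psi x := (\sum_(a \in setT) w a x)^-1 *: \sum_(a \in setT) w a x *: phi a.
have sumE (U : nmodType) (F : V -> U) s : uniq s ->
    (forall a, a \notin s -> F a = 0) ->
    \sum_(a \in setT) F a = \sum_(a <- s) F a.
  move=> us Fs; rewrite (fsbigE s)// => [|a _ /Fs//].
  by apply: eq_bigl => a; rewrite in_setT.
have psiE s x : uniq s -> (forall a, a \notin s -> w a x = 0) ->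
    psi x = (\sum_(a <- s) w a x)^-1 *: \sum_(a <- s) w a x *: phi a.
  move=> us ws; rewrite /psi (sumE _ _ s)// (sumE _ _ s)// => a /ws ->.
  exact: scale0r.
have w_sum_gt0 s x : (forall a, a \notin s -> w a x = 0) ->
    0 < \sum_(a <- s) w a x.
  move=> ws; have [a wa] := weight_neq0_ex wo x.
  have sa : a \in s by apply: contraNT wa => /ws/eqP.
  rewrite (big_rem a)//= ltr_pwDl//.
    by rewrite lt_neqAle eq_sym wa weight_ge0.
  by apply: sumr_ge0 => b _; exact: weight_ge0.
exists psi => x; have [s us ws] := weight_locally_finite wo x.
  have wx := w_sum_gt0 _ _ (nbhs_singleton ws).
  rewrite /prop_for /continuous_at (psiE s)//; last exact: nbhs_singleton ws.
  apply: cvg_trans.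
    apply: (near_eq_cvg (f := fun y =>
      (\sum_(a <- s) w a y)^-1 *: \sum_(a <- s) w a y *: phi a)).
    by apply: filterS ws => y ws; rewrite (psiE s).
  apply: cvgZ.
    apply: cvgV; first by rewrite gt_eqF.
    by apply: (@continuous_sum _ V R^o) => a; exact: weight_continuous.
  apply: continuous_sum => a y; apply: cvgZr_tmp.
  exact: weight_continuous.
have {}ws := nbhs_singleton ws; have wx := w_sum_gt0 _ _ ws.
have -> : psi x - phi x =
    (\sum_(a <- s) w a x)^-1 *: \sum_(a <- s) w a x *: (phi a - phi x).
  under [X in _ *: X]eq_bigr do rewrite scalerBr.
  rewrite sumrB scalerBr -scaler_suml scalerA mulVf ?gt_eqF// scale1r.
  by rewrite (psiE s).
rewrite normrZ gtr0_norm ?invr_gt0// mulrC ler_pdivrMr// mulr_sumr.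
apply: (le_trans (ler_norm_sum _ _ _)); apply: ler_sum => a _.
rewrite normrZ ger0_norm ?weight_ge0// mulrC.
have [->|wa] := eqVneq (w a x) 0; first by rewrite !mulr0.
rewrite ler_wpM2r ?weight_ge0// phiC//.
by rewrite distrC ltW// (weight_supp wo wa).
Qed.

(** * Coarse and expanding maps *)

Section CoarseMaps.
Context {R : realType} {V W : normedModType R}.
Implicit Type f : V -> W.

Lemma coarseP f : coarse f <-> forall t : R, 0 <= t ->
  exists C : R, forall x y, `|x - y| <= t -> `|f x - f y| <= C.
Proof.
split=> [cf t t0|cf t /cf[C fC]]; last first.
  apply: (@le_lt_trans _ _ C%:E); last exact: ltry.
  by apply: ge_ereal_sup => _ [[x y] /= xy <-]; rewrite lee_fin fC.
have := cf _ t0; exists (fine (omega f t)) => x y xy.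
have fxy : ((`|f x - f y|)%:E <= omega f t)%E.
  by apply: ereal_sup_ubound; exists (x, y).
rewrite -lee_fin fineK// fin_numElt cf// andbT.
by apply: lt_le_trans fxy; exact: ltNyr.
Qed.

Lemma expandingP f : expanding f <-> forall A : R,
  exists T : R, forall x y, T <= `|x - y| -> A <= `|f x - f y|.
Proof.
split=> [/cvgeyPge ef A|ef].
  have [T [_ hT]] := ef A; exists (T + 1) => x y xy; rewrite -lee_fin.
  have /le_trans : (A%:E <= rho f (T + 1))%E by apply: hT; rewrite ltrDl.
  by apply; apply: ereal_inf_lbound; exists (x, y).
apply/cvgeyPge => A; have [T hT] := ef A; exists T; split; first exact: num_real.
move=> t Tt; apply: le_ereal_inf_tmp => _ [[x y] /= xy <-]; rewrite lee_fin.
by apply: hT; apply: le_trans xy; exact: ltW.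
Qed.

(** Subdivide the segment from [x] to [y] into at most [|x - y| + 1] steps of
    length at most [1], each of which costs at most [C]. *)
Lemma coarse_affine_bound f : coarse f ->
  exists C : R, forall x y, `|f x - f y| <= C * (`|x - y| + 1).
Proof.
move=> /coarseP/(_ 1 ler01)[C fC].
have C0 : 0 <= C by apply: le_trans (fC 0 0 _); rewrite // subrr normr0.
have step n x y : `|x - y| <= n.+1%:R -> `|f x - f y| <= C * n.+1%:R.
  elim: n x y => [|n IHn] x y xy; first by rewrite mulr1 fC.
  have n0 : 0 < n.+2%:R^-1 :> R by rewrite invr_gt0.
  (* The last step of the subdivision goes from [z] to [y]. *)
  pose z := y + n.+2%:R^-1 *: (x - y).
  have zy : z - y = n.+2%:R^-1 *: (x - y) by rewrite addrC addKr.
  have xz : x - z = (n.+1%:R / n.+2%:R) *: (x - y).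
    rewrite opprD addrA -{1}[x - y]scale1r -scalerBl; congr (_ *: _).
    by rewrite -[n.+1%:R](addrK 1) natr1 mulrBl divff// mul1r.
  rewrite -(subrKA (f z)) (le_trans (ler_normD _ _))// -natr1 mulrDr lerD//.
    apply: IHn; rewrite xz normrZ ger0_norm ?divr_ge0// -mulrA mulrC.
    rewrite -ler_pdivlMr// divff// mulrC ler_pdivrMr// mul1r.
    exact: xy.
  rewrite mulr1; apply: fC; rewrite zy normrZ gtr0_norm// mulrC ler_pdivrMr//.
  by rewrite mul1r.
exists C => x y.
have /andP[nxy xyn] := truncn_itv (normr_ge0 (x - y)).
by rewrite (le_trans (step _ _ _ (ltW xyn)))// -natr1 ler_wpM2l// lerD2r.
Qed.

Lemma continuous_coarse_embedding f : coarse_embedding f ->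
  exists2 g : V -> W, continuous g & coarse_embedding g.
Proof.
move=> [/coarseP cf /expandingP ef].
have [C fC] := cf _ ler01; have [g gc gf] := continuous_approximation fC.
exists g => //; split.
  apply/coarseP => t /cf[D fD]; exists (C + D + C) => x y /fD xy.
  have := ler_distD (f x) (g x) (g y); have := ler_distD (f y) (f x) (g y).
  have := gf x; have := gf y; rewrite (distrC (g y) (f y)); lra.
apply/expandingP => A; have [T fT] := ef (A + C + C); exists T => x y /fT xy.
have := ler_distD (g x) (f x) (f y); have := ler_distD (g y) (g x) (f y).
have := gf x; have := gf y; rewrite (distrC (g x) (f x)); lra.
Qed.

End CoarseMaps.

(** * Norm estimates in the [E]-sum *)

Section Oplus.
Context {R : realType} (Y E : completeNormedModType R) (e : nat -> E).
Context (he : one_unconditional_basic_sequence e).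

Lemma summable_along_geometric (y : nat -> Y) (K : R) :
  (forall n, `|y n| * `|e n| <= K * 2^-1 ^+ n) -> y \in summable_along Y he.
Proof.
move=> yK; apply/summable_alongP/normed_cvg.
apply: (@series_le_cvg _ _ (geometric K 2^-1)) => [n|n|n|].
- exact: normr_ge0.
- by apply: le_trans (yK n); rewrite mulr_ge0.
- by rewrite /= normrZ normr_id.
- by apply: is_cvg_geometric_series; rewrite gtr0_norm ?invf_lt1 ?ltr1n.
Qed.

Lemma oplus_coord_le (y : oplus Y he) k : `|y k| * `|e k| <= `|y|.
Proof.
rewrite -(normr_id (y k)) oplus_normE; apply: (unconditional_coord he).
exact/summable_alongP/oplus_valP.
Qed.

Lemma oplus_norm_le (y : oplus Y he) (K : R) N : 0 <= K ->
  (forall n, (N <= n)%N -> `|y n| * `|e n| <= K * 2^-1 ^+ n) ->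
  `|y| <= \sum_(k < N) `|y k| * `|e k| + 2 * K * 2^-1 ^+ N.
Proof.
move=> K0 yK; have /summable_alongP cy := oplus_valP y.
rewrite oplus_normE; apply: (cvgr_to_le (cvg_norm cy)).
exists N => // n /= Nn.
apply: (le_trans (ler_norm_sum _ _ _)).
rewrite (eq_bigr (fun k => `|y k| * `|e k|)); last first.
  by move=> k _; rewrite normrZ normr_id.
rewrite (big_cat_nat (leq0n N) Nn)/= big_mkord lerD2l -(subnKC Nn).
(* The subtracted term makes the induction on the length of the sum work. *)
suff : \sum_(N <= k < N + (n - N)) `|y k| * `|e k| <=
    2 * K * 2^-1 ^+ N - 2 * K * 2^-1 ^+ (N + (n - N)).
  move/le_trans; apply; rewrite gerBl mulr_ge0// ?mulr_ge0// exprn_ge0//.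
elim: (n - N)%N => [|m IHm]; first by rewrite addn0 big_geq// subrr.
rewrite addnS big_nat_recr ?leq_addr//= exprS.
have := yK (N + m)%N (leq_addr _ _); move: IHm; lra.
Qed.

End Oplus.

(** * Inverses with a modulus of continuity *)

Section InverseModulus.
Context {R : realType} {V W : normedModType R}.

Lemma unif_continuous_inverse_of_gap (f : V -> W) :
  (forall d : R, 0 < d -> exists2 c : R, 0 < c &
     forall x y, d <= `|x - y| -> c <= `|f x - f y|) ->
  unif_continuous_inverse f.
Proof.
move=> gap; pose g w := xget 0 [set x | f x = w].
have gK : cancel f g.
  move=> x; have fg : f (g (f x)) = f x.
    by apply: (@xgetPex _ 0 [set z | f z = f x]); exists x.
  apply/eqP; rewrite -subr_eq0 -normr_le0 leNgt; apply/negP => /gap[c c0].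
  by move=> /(_ _ _ (lexx _)); rewrite fg subrr normr0 leNgt c0.
exists g => //; apply/unif_continuousP => d d0.
have [c c0 hc] := gap _ d0; exists c => //.
move=> [w z]; rewrite ball_subspace_ball /subspace_ball/=.
case: ifPn => [|_ ->]; last exact: ballxx.
rewrite inE => -[x _ <-] [[y _ <-]]; rewrite !gK -!ball_normE/= => xy.
by rewrite ltNge; apply/negP => /hc; rewrite leNgt xy.
Qed.

Lemma homeomorphism_of_unif_continuous_inverse (f : V -> W) :
  continuous f -> unif_continuous_inverse f -> homeomorphism_onto_image f.
Proof.
move=> cf [g gK /unif_continuousP ug]; split=> //; exists g => // w.
apply/cvg_ballP => d /ug[c c0 gc]; apply: filterS (nbhsx_ballx w _ c0) => z.
exact: (gc (w, z)).
Qed.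

End InverseModulus.

(** * The multiscale map *)

Section Multiscale.
Context {R : realType} {X Y E : completeNormedModType R} {e : nat -> E}.
Context (he : one_unconditional_basic_sequence e).
Variables (phi : X -> Y) (C : R).
Hypothesis phiC : forall x y, `|phi x - phi y| <= C * (`|x - y| + 1).

(** Dividing by [n + 1] compensates the magnification in the affine bound of
    [phi], and dividing by [|e n|] makes the [n]-th coordinate contribute at most
    a multiple of [2 ^- n], as [e] is not normalized. *)
Definition scales x n : Y :=
  (2^-1 ^+ n / (n.+1%:R * `|e n|)) *: phi (n.+1%:R *: x).

Let e_gt0 n : 0 < `|e n|.
Proof. by rewrite normr_gt0 (basic_sequence_neq0 he). Qed.

Let coef_gt0 n : 0 < 2^-1 ^+ n / (n.+1%:R * `|e n|).
Proof. by rewrite divr_gt0 ?exprn_gt0 ?mulr_gt0. Qed.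

Let C_ge0 : 0 <= C.
Proof. by have := phiC 0 0; rewrite !subrr !normr0 add0r mulr1. Qed.

Lemma scales_dist x y n : `|scales x n - scales y n| * `|e n| =
  2^-1 ^+ n / n.+1%:R * `|phi (n.+1%:R *: x) - phi (n.+1%:R *: y)|.
Proof.
rewrite -scalerBr normrZ gtr0_norm// mulrAC; congr (_ * _).
by rewrite invfM mulrA mulfVK// gt_eqF.
Qed.

Lemma scales_dist_le x y n :
  `|scales x n - scales y n| * `|e n| <= C * (`|x - y| + 1) * 2^-1 ^+ n.
Proof.
rewrite scales_dist mulrAC [leRHS]mulrC -mulrA ler_wpM2l ?exprn_ge0//.
rewrite ler_pdivrMr// (le_trans (phiC _ _))// -mulrA ler_wpM2l//.
rewrite -scalerBr normrZ ger0_norm// mulrDl mul1r mulrC lerD2l.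
by rewrite ler1n.
Qed.

Lemma scales_summable x : scales x \in summable_along Y he.
Proof.
apply: (@summable_along_geometric _ _ _ _ _ _ (C * (`|x| + 1) + `|phi 0|)) => n.
have s0 : `|scales 0 n| * `|e n| <= `|phi 0| * 2^-1 ^+ n.
  rewrite /scales scaler0 normrZ gtr0_norm// mulrAC mulrC ler_wpM2l//.
  rewrite invfM mulrA mulfVK ?gt_eqF// ler_pdivrMr//.
  by rewrite ler_peMr ?exprn_ge0// ler1n.
have := scales_dist_le x 0 n; rewrite subr0 mulrDl => xn.
apply: le_trans (lerD xn s0).
by rewrite -mulrDl ler_wpM2r// -{1}(subrK (scales 0 n) (scales x n)) ler_normD.
Qed.

Definition multiscale x : oplus Y he := Oplus (scales_summable x).

Lemma multiscale_coarse : coarse multiscale.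
Proof.
apply/coarseP => t t0; exists (2 * (C * (t + 1))) => x y xy.
have K0 : 0 <= C * (t + 1) by rewrite mulr_ge0// addr_ge0.
have := @oplus_norm_le _ _ _ _ _ (multiscale x - multiscale y) _ 0 K0.
rewrite big_ord0 add0r expr0 mulr1; apply => n _.
apply: le_trans (scales_dist_le x y n) _.
by rewrite ler_wpM2r ?exprn_ge0// ler_wpM2l// lerD2r.
Qed.

Lemma multiscale_dist_ge x y n :
  2^-1 ^+ n / n.+1%:R * `|phi (n.+1%:R *: x) - phi (n.+1%:R *: y)| <=
  `|multiscale x - multiscale y|.
Proof.
by rewrite -scales_dist; exact: (oplus_coord_le (multiscale x - multiscale y)).
Qed.

Lemma multiscale_expanding : expanding phi -> expanding multiscale.
Proof.
move=> /expandingP ephi; apply/expandingP => A; have [T hT] := ephi A.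
exists T => x y /hT xy; apply: le_trans xy _.
by have := multiscale_dist_ge x y 0; rewrite expr0 divr1 mul1r !scale1r.
Qed.

(** Split off the first [N] coordinates: the tail is small uniformly in the [y]
    with [|x - y| <= 1], and the head is a finite sum of continuous functions. *)
Lemma multiscale_continuous : continuous phi -> continuous multiscale.
Proof.
move=> cphi x; apply/cvgrPdist_le => d d0.
have d20 : 0 < d / 2 by rewrite divr_gt0.
(* [K] is [C * (|x - y| + 1)] with [|x - y|] at its largest value [1]. *)
pose K := C * 2; have K0 : 0 <= K by rewrite mulr_ge0.
have [N hN] : exists N, 2 * K * 2^-1 ^+ N <= d / 2.
  have h1 : `|2^-1 : R| < 1 by rewrite gtr0_norm ?invf_lt1 ?ltr1n.
  have /cvgr0_norm_le/(_ _ d20)[N _ /(_ N (leqnn N)) hN] :=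
    @cvg_geometric R (2 * K) _ h1.
  by exists N; apply: le_trans hN; exact: ler_norm.
pose head y := \sum_(k < N) 2^-1 ^+ k / k.+1%:R *
    `|phi (k.+1%:R *: x) - phi (k.+1%:R *: y)|.
have head_small : \forall y \near x, head y <= d / 2.
  have headx : head x = 0.
    by rewrite /head big1// => k _; rewrite subrr normr0 mulr0.
  have headc : head y @[y --> x] --> head x.
    apply: (@cvg_big R^o) => [|k _]; first exact: add_continuous.
    apply: cvgM; first exact: cvg_cst.
    apply: cvg_norm; apply: cvgB; first exact: cvg_cst.
    apply: (continuous_comp (f := fun y : X => k.+1%:R *: y)); last exact: cphi.
    by apply: cvgZl_tmp; exact: cvg_id.
  have /cvgrPdist_le/(_ _ d20) := headc; apply: filterS => y.
  by rewrite headx sub0r normrN => /(le_trans (ler_norm _)).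
near=> y.
have xy : `|x - y| <= 1.
  near: y; apply: (cvgr_dist_le (FF := nbhs_filter x)); last exact: ltr01.
  exact: cvg_id.
rewrite [leRHS]splitr.
apply: le_trans
  (@oplus_norm_le _ _ _ _ _ (multiscale x - multiscale y) K N K0 _) _.
  move=> n _; apply: le_trans (scales_dist_le x y n) _.
  by rewrite ler_wpM2r ?exprn_ge0// ler_wpM2l//; lra.
apply: lerD => //.
under eq_bigr do rewrite (scales_dist x y).
by near: y.
Unshelve. all: by end_near. Qed.

(** Points at distance at least [d] are sent beyond the threshold [T] of [phi] by
    a magnification [n + 1 >= T / d], so the [n]-th coordinate separates them by
    an amount that depends on [d] alone. *)
Lemma multiscale_unif_continuous_inverse : expanding phi ->
  unif_continuous_inverse multiscale.
Proof.
move=> /expandingP/(_ 1)[T hT]; apply: unif_continuous_inverse_of_gap => d d0.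
have [n Tn] : exists n : nat, T <= n.+1%:R * d.
  exists (Num.truncn (`|T| / d)); have := ltW (truncnS_gt (`|T| / d)).
  by rewrite ler_pdivrMr//; apply: le_trans; exact: ler_norm.
exists (2^-1 ^+ n / n.+1%:R) => [|x y xy]; first by rewrite divr_gt0 ?exprn_gt0.
apply: le_trans (multiscale_dist_ge x y n).
rewrite ler_peMr ?divr_ge0 ?exprn_ge0//; apply: hT.
by rewrite -scalerBr normrZ ger0_norm// (le_trans Tn)// ler_wpM2l.
Qed.

End Multiscale.

Theorem theorem1p6 (R : realType) (X Y E : completeNormedModType R)
    (e : nat -> E) (he : one_unconditional_basic_sequence e) :
  (exists phi : X -> Y, coarse_embedding phi) ->
  (exists f : X -> oplus Y he,
    [/\ continuous f, coarse_embedding f & unif_continuous_inverse f]) /\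
  (exists h : X -> oplus Y he,
    homeomorphism_onto_image h /\ coarse_embedding h).
Proof.
move=> [phi /continuous_coarse_embedding[psi cpsi [psi_coarse psi_exp]]].
have [C psiC] := coarse_affine_bound psi_coarse.
pose f := multiscale he psiC.
have cf : continuous f := multiscale_continuous cpsi.
have ef : coarse_embedding f.
  by split; [exact: multiscale_coarse|exact: multiscale_expanding].
have uf : unif_continuous_inverse f by exact: multiscale_unif_continuous_inverse.
by split; exists f; split=> //; exact: homeomorphism_of_unif_continuous_inverse.
Qed.
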